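(* Let $1\le p<\infty$, $p\ne2$. There exists a normal Schauder decomposition in $L_p(0,1)$ which is not a Schauder-Orlicz decomposition.
   Context: $L_p(0,1)$ is taken with Lebesgue measure. A Schauder decomposition of a Banach space $X$ is a sequence $\{\mathfrak{M}_n\}_{n=0}^{\infty}$ of closed nonzero linear subspaces of $X$ such that each $x\in X$ has a unique norm convergent expansion $x=\sum_{n=0}^{\infty}x_n$ with $x_n\in\mathfrak{M}_n$ for all $n$. Its associated sequence of coordinate projections (a.s.c.p.) $\{P_n\}_{n=0}^{\infty}$ is defined by $P_nx=x_n$; each $P_n$ is bounded. The decomposition is normal if $\|P_n\|=1$ for all $n$. An Orlicz function is a continuous, nondecreasing, convex function $\Phi:[0,\infty)\to[0,\infty)$ with $\Phi(0)=0$ and $\lim_{t\to\infty}\Phi(t)=\infty$ (it may be degenerate, i.e. $\Phi(t)=0$ for some $t>0$). A Schauder decomposition of $X$ with a.s.c.p. $\{P_n\}$ is a Schauder-Orlicz decomposition if there exists an Orlicz function $\Phi$ such that for every $x\in X$: $\inf\{\rho>0:\sum_{n=0}^{\infty}\Phi(\|P_nx\|/\rho)\le 1\}=\|x\|$. *)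

(* Defs.v *)
From HB Require Import structures.
From mathcomp Require Import all_boot all_order all_algebra.
From mathcomp Require Import all_classical all_reals all_analysis.
From mathcomp Require Import ess_sup_inf measurable_realfun.

Set Implicit Arguments.
Unset Strict Implicit.
Unset Printing Implicit Defensive.

Import Order.TTheory GRing.Theory Num.Theory.
Import numFieldNormedType.Exports.

Local Open Scope classical_set_scope.
Local Open Scope ring_scope.

(* [LspaceType mu p1] is the library's type of classes, modulo equality almost
   everywhere, of the measurable functions having a finite p-norm; the library
   gives it no algebraic structure. Below it becomes a normed space: the
   operations are those of representatives and the norm is ['N[mu]_p]. *)
Section Lspace_normedModType.
Context d (T : measurableType d) (R : realType).
Variables (mu : {measure set T -> \bar R}) (p : \bar R) (p1 : (1 <= p)%E).

Local Notation L := (LspaceType mu p1).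
Local Notation LF := (LfunType mu p1).
Local Notation Q := ({mfun_ mu, T >-> measurableTypeR R}).

HB.instance Definition _ := gen_eqMixin L.
HB.instance Definition _ := gen_choiceMixin L.

Lemma ae_eq_Lnorm (f g : T -> R) :
  measurable_fun setT f -> measurable_fun setT g -> f = g %[ae mu] ->
  ('N[mu]_p[EFin \o f] = 'N[mu]_p[EFin \o g])%E.
Proof.
move=> mf mg fg; rewrite unlock /Lnorm.
case: p p1 => [r r1|_|//]; last first.
  case: ifPn => // _; apply: eq_ess_sup.
  by apply: filterS fg => x /(_ I) /= ->.
have mpow (h : T -> R) : measurable_fun setT h ->
    measurable_fun setT (fun x => `|(EFin \o h) x| `^ r)%E.
  move=> mh; exact: (measurableT_comp (measurable_poweR r) (measurableT_comp
    (@abse_measurable R setT) (measurableT_comp (@EFin_measurable R setT) mh))).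
congr (_ `^ _)%E; apply: ae_eq_integral => //; [exact: mpow|exact: mpow|].
by apply: filterS fg => x /[apply] /= ->.
Qed.

Section class.
Variable f : LF.

Let mf : @measurable_fun _ _ T (measurableTypeR R) setT f.
Proof. exact: (@measurable_funPT _ _ _ _ f). Qed.

Let fmR : {mfun T >-> measurableTypeR R} :=
  MeasurableFun.Pack (MeasurableFun.Class (isMeasurableFun.Build _ _ _ _ _ mf)).

Let q : Q := \pi_(Q)%qT fmR.

Let q_ae : (q : T -> R) = f %[ae mu].
Proof. by have /eqmodP/asboolP := reprK q. Qed.

Let mq : @measurable_fun _ _ T R setT q.
Proof. exact: (@measurable_funPT _ _ _ _ (repr q)). Qed.

Let q_fin : finite_norm mu p q.
Proof.
rewrite /finite_norm (ae_eq_Lnorm _ _ q_ae)//; exact: Lfunction_finite.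
Qed.

Definition Lspace_of : L :=
  LebesgueSpace.Pack (LebesgueSpace.Class (isFinLebesgue.Build _ _ _ _ _ p1 _ q_fin)).

Lemma Lspace_ofE : (Lspace_of : T -> R) = f %[ae mu].
Proof. exact: q_ae. Qed.

End class.

Lemma Lspace_measurable (x : L) : @measurable_fun _ _ T R setT x.
Proof. exact: (@measurable_funPT _ _ _ _ (repr (x : Q))). Qed.

Lemma Lspace_Lfun (x : L) : (x : T -> R) \in Lfun mu p.
Proof.
apply/andP; split; rewrite inE; first exact: Lspace_measurable.
exact: Lebesgue_finite.
Qed.

Definition Lfun_of (x : L) : LF := Lfun_Sub p1 (Lspace_Lfun x).

Lemma Lspace_eqP (x y : L) : x = y <-> (x : T -> R) = y %[ae mu].
Proof.
split=> [->|xy]; first exact: ae_eq_refl.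
have : (x : Q) = y.
  rewrite -[LHS]reprK -[RHS]reprK; apply/eqmodP.
  exact/asboolP.
case: x y {xy} => x [[xf]] [y [[yf]]] /= xy.
by subst y; rewrite (Prop_irrelevance xf yf).
Qed.

Definition Lspace_zero : L := Lspace_of 0.
Definition Lspace_opp (x : L) : L := Lspace_of (- Lfun_of x).
Definition Lspace_add (x y : L) : L := Lspace_of (Lfun_of x + Lfun_of y).
Definition Lspace_scale (a : R) (x : L) : L := Lspace_of (a *: Lfun_of x).
Definition Lspace_norm (x : L) : R := fine ('N[mu]_p[EFin \o x])%E.

Let Lspace_of_eq (f g : LF) :
  (f : T -> R) = g %[ae mu] -> Lspace_of f = Lspace_of g.
Proof.
move=> fg; apply/Lspace_eqP.
apply: ae_eq_trans (Lspace_ofE f) _; apply: ae_eq_trans fg _.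
exact/ae_eq_sym/Lspace_ofE.
Qed.

Let Lspace_ind (P : L -> Prop) : (forall f, P (Lspace_of f)) -> forall x, P x.
Proof.
move=> PL x; suff <- : Lspace_of (Lfun_of x) = x by exact: PL.
by apply/Lspace_eqP; exact: Lspace_ofE.
Qed.

Let oppE f : Lspace_opp (Lspace_of f) = Lspace_of (- f).
Proof.
apply: Lspace_of_eq; apply: filterS (Lspace_ofE f) => x fx Tx.
exact: (congr1 (fun u : R => - u) (fx Tx)).
Qed.

Let addE f g : Lspace_add (Lspace_of f) (Lspace_of g) = Lspace_of (f + g).
Proof.
apply: Lspace_of_eq; apply: filterS2 (Lspace_ofE f) (Lspace_ofE g).
by move=> x fx gx Tx; exact: (congr2 (fun u v : R => u + v) (fx Tx) (gx Tx)).
Qed.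

Let scaleE a f : Lspace_scale a (Lspace_of f) = Lspace_of (a *: f).
Proof.
apply: Lspace_of_eq; apply: filterS (Lspace_ofE f) => x fx Tx.
exact: (congr1 (fun u : R => a * u) (fx Tx)).
Qed.

Let normE f : Lspace_norm (Lspace_of f) = fine ('N[mu]_p[EFin \o f])%E.
Proof.
rewrite /Lspace_norm (ae_eq_Lnorm _ _ (Lspace_ofE f))//.
exact: Lspace_measurable.
Qed.

Let addA : associative Lspace_add.
Proof.
elim/Lspace_ind => f; elim/Lspace_ind => g; elim/Lspace_ind => h.
by rewrite !addE addrA.
Qed.

Let addC : commutative Lspace_add.
Proof.
by elim/Lspace_ind => f; elim/Lspace_ind => g; rewrite !addE addrC.
Qed.

Let add0 : left_id Lspace_zero Lspace_add.
Proof. by elim/Lspace_ind => f; rewrite addE add0r. Qed.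

Let addN : left_inverse Lspace_zero Lspace_opp Lspace_add.
Proof. by elim/Lspace_ind => f; rewrite oppE addE addNr. Qed.

HB.instance Definition _ := GRing.isZmodule.Build L addA addC add0 addN.

Let plusE f g : Lspace_of f + Lspace_of g = Lspace_of (f + g).
Proof. exact: addE. Qed.

Let scaleA a b x :
  Lspace_scale a (Lspace_scale b x) = Lspace_scale (a * b) x.
Proof. by elim/Lspace_ind: x => f; rewrite !scaleE scalerA. Qed.

Let scale1 : left_id 1 Lspace_scale.
Proof. by elim/Lspace_ind => f; rewrite scaleE scale1r. Qed.

Let scaleDr : right_distributive Lspace_scale +%R.
Proof.
move=> a; elim/Lspace_ind => f; elim/Lspace_ind => g.
by rewrite plusE !scaleE plusE scalerDr.
Qed.

Let scaleDl x : {morph Lspace_scale^~ x : a b / a + b}.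
Proof.
move=> a b; elim/Lspace_ind: x => f.
by rewrite !scaleE plusE scalerDl.
Qed.

HB.instance Definition _ :=
  GRing.Zmodule_isLmodule.Build R L scaleA scale1 scaleDr scaleDl.

Let normD x y : Lspace_norm (x + y) <= Lspace_norm x + Lspace_norm y.
Proof.
elim/Lspace_ind: x => f; elim/Lspace_ind: y => g.
by rewrite plusE !normE ler_LnormD.
Qed.

Let normZ a x : Lspace_norm (a *: x) = `|a| * Lspace_norm x.
Proof.
elim/Lspace_ind: x => f; rewrite [a *: _]scaleE !normE.
by rewrite LnormZ -finite_norm_fine.
Qed.

Let norm0_eq0 x : Lspace_norm x = 0 -> x = 0.
Proof.
elim/Lspace_ind: x => f; rewrite normE => /fine_Lnormr_eq0 f0.
exact: Lspace_of_eq.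
Qed.

HB.instance Definition _ := Lmodule_isNormed.Build R L normD normZ norm0_eq0.

Lemma Lspace_addE (x y : L) :
  ((x + y : L) : T -> R) = (fun t => (x : T -> R) t + (y : T -> R) t) %[ae mu].
Proof. exact: Lspace_ofE. Qed.

Lemma Lspace_scaleE (a : R) (x : L) :
  ((a *: x : L) : T -> R) = (fun t => a * (x : T -> R) t) %[ae mu].
Proof. exact: Lspace_ofE. Qed.

Lemma Lspace_normE (x : L) : `|x|%:E = ('N[mu]_p[EFin \o x])%E.
Proof. exact: (finite_norm_fine (Lfun_of x)). Qed.

End Lspace_normedModType.

(* Lebesgue measure on the line restricted to ]0, 1[: what a function does
   outside ]0, 1[ is negligible, so that its L_p space is L_p(0, 1). *)
Definition lebesgue01 (R : realType) :
    {measure set (measurableTypeR R) -> \bar R} :=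
  mrestr (@lebesgue_measure R) (measurable_itv `]0%R, 1%R[).

Section Schauder.
Context (R : realType) (X : normedModType R).
Implicit Types M : nat -> set X.

Definition schauder_expansion M (x : X) (u : nat -> X) : Prop :=
  (forall n, M n (u n)) /\ series u @ \oo --> x.

Definition schauder_decomposition M : Prop :=
  [/\ forall n, [/\ closed (M n), GRing.submod_closed (mem (M n)) &
                    M n <> [set 0]] &
      forall x, exists! u, schauder_expansion M x u].

(* The coordinate projections of a decomposition: [ascp M n x] is the n-th term
   of the expansion of [x], the default value 0 being irrelevant as soon as [M]
   is a Schauder decomposition. *)
Definition ascp M (n : nat) (x : X) : X :=
  xget (fun=> 0) [set u | schauder_expansion M x u] n.

(* extended-real valued, so that an unbounded map has norm +oo *)
Definition opnorm (f : X -> X) : \bar R :=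
  ereal_sup [set `|f x|%:E | x in [set x : X | `|x| <= 1]].

Definition normal_schauder_decomposition M : Prop :=
  schauder_decomposition M /\ forall n, opnorm (ascp M n) = 1%E.

(* A function [0, oo[ -> [0, oo[ is represented by a function on R of which
   only the values on [0, oo[ matter. *)
Definition orlicz_function (Phi : R -> R) : Prop :=
  [/\ {within `[0, +oo[, continuous Phi},
      forall t : R, 0 <= t -> 0 <= Phi t,
      {in `[0, +oo[ &, {homo Phi : s t / s <= t}},
      @convex_function R R^o `[0, +oo[%classic Phi &
      Phi 0 = 0 /\ Phi t @[t --> +oo] --> +oo].

(* The infimum is taken in the extended reals (inf of the empty set is +oo). *)
Definition schauder_orlicz_decomposition M : Prop :=
  schauder_decomposition M /\
  exists2 Phi, orlicz_function Phi &
  forall x : X,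
    ereal_inf [set rho%:E | rho in [set rho : R | 0 < rho /\
      (\sum_(0 <= n <oo) (Phi (`|ascp M n x| / rho))%:E <= 1)%E]] = `|x|%:E.

End Schauder.

(* Main.v *)
Require Import Defs.
From HB Require Import structures.
From mathcomp Require Import all_boot all_order all_algebra.
From mathcomp Require Import all_classical all_reals all_analysis.
From mathcomp Require Import measurable_realfun ring lra.

(** The even and odd parts of a function give the counterexample. Let T be a
    linear isometric involution of L_p. Both (1 + T)/2 and (1 - T)/2 are
    contractions, so splitting a function into its T-even and T-odd parts is a
    decomposition into two pieces by norm-one projections. When T is the
    composition with the reflection t |-> 1 - t, this splitting is not the
    l_p-sum of its pieces: a function y supported in the left half has even
    part (y + Ty)/2 and odd part (y - Ty)/2, and as y and Ty have disjoint
    supports both parts have the norm c with 2^p c^p = 2 |y|^p.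

    Cut ]0, 1[ into countably many pieces A_0, A_1, ... of positive measure, the
    first one being symmetric, restrict functions to the pieces, and split
    the first restriction further into even and odd parts. The resulting
    projections are contractive, mutually orthogonal and sum up to the identity,
    hence they define a normal Schauder decomposition
    ([normal_schauder_resolution], [contractive_resolution_split],
    [contractive_resolution_restr]).

    In a Schauder-Orlicz decomposition the norm of a sum of two vectors taken in
    different components depends only on the norms of the two vectors
    ([schauder_orlicz_norm]). Here, two vectors of norm c living on A_1 and A_2
    have a sum z with |z|^p = 2 c^p, while the even and odd parts of y
    have sum y with 2 |y|^p = 2^p c^p. Equality of the two norms forces
    2^p = 4, that is p = 2 ([not_schauder_orlicz_reflected]). *)

Set Implicit Arguments.
Unset Strict Implicit.
Unset Printing Implicit Defensive.

Import Order.TTheory GRing.Theory Num.Theory.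
Import numFieldNormedType.Exports.

Local Open Scope classical_set_scope.
Local Open Scope ring_scope.

(** * Schauder decompositions given by contractive projections *)

(** The data of a normal Schauder decomposition seen from its projections. *)
Record contractive_resolution (R : realType) (X : normedModType R)
    (P : nat -> {linear X -> X}) : Prop := ContractiveResolution {
  resolution_orthogonal : forall i j x, P i (P j x) = if i == j then P j x else 0 ;
  resolution_contractive : forall i x, `|P i x| <= `|x| ;
  resolution_neq0 : forall i, exists x, P i x != 0 ;
  resolution_sum : forall x, series (fun n => P n x) @ \oo --> x }.

Section resolution.
Context (R : realType) (X : normedModType R) (P : nat -> {linear X -> X}).
Hypothesis hP : contractive_resolution P.

Let M n : set X := range (P n).

Lemma resolution_idem n x : P n (P n x) = P n x.
Proof. by rewrite (resolution_orthogonal hP) eqxx. Qed.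

Lemma mem_range_resolution n x : M n x <-> P n x = x.
Proof.
split=> [[y _ <-]|<-]; last by exists x.
exact: resolution_idem.
Qed.

Lemma resolution_continuous n : continuous (P n).
Proof.
move=> x; apply/cvgrPdist_le => e e0; near=> y.
rewrite -raddfB; apply: le_trans (resolution_contractive hP _ _) _.
by near: y; exact: cvgr_dist_le.
Unshelve. all: end_near. Qed.

(** The range is the fixed-point set of a continuous map: a point of its closure
    is moved by [P n] at most twice as far as its distance to the range. *)
Lemma closed_range_resolution n : closed (M n).
Proof.
move=> x clx; apply/mem_range_resolution; apply/eqP; rewrite -subr_eq0 -normr_le0.
apply/ler_addgt0Pr => e e0; rewrite add0r.
have [|y [My yx]] := clx (ball x (e / 2)).
  by apply: nbhsx_ballx; rewrite divr_gt0.
have -> : P n x - x = P n (x - y) - (x - y).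
  by rewrite raddfB /= (iffLR (mem_range_resolution n y) My) opprB addrA subrK.
rewrite (le_trans (ler_normB _ _))// [leRHS]splitr lerD//.
  rewrite (le_trans (resolution_contractive hP _ _))//.
  by move: yx; rewrite -ball_normE/= => /ltW.
by move: yx; rewrite -ball_normE/= => /ltW.
Qed.

Lemma resolution_expansion x : schauder_expansion M x (fun n => P n x).
Proof. by split=> [n|]; [exists x|exact: (resolution_sum hP)]. Qed.

(** Applying the continuous map [P n] to the partial sums of an expansion gives a
    sequence which is eventually constant, equal to the n-th term. *)
Lemma resolution_expansion_unique x u :
  schauder_expansion M x u -> u = fun n => P n x.
Proof.
move=> [Mu ux]; apply/funext => n; apply/esym.
have cPx : P n (series u k) @[k --> \oo] --> P n x.
  by apply: continuous_cvg => //; exact: resolution_continuous.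
have cu : P n (series u k) @[k --> \oo] --> u n.
  apply: cvg_near_cst; near=> k.
  have nk : (n < k)%N by near: k; exact: nbhs_infty_gt.
  rewrite /series/= raddf_sum/= (bigD1_seq n) ?iota_uniq//=; last first.
    by rewrite mem_index_iota.
  rewrite (iffLR (mem_range_resolution n _) (Mu n)) big1 ?addr0// => j jn.
  rewrite -(iffLR (mem_range_resolution j _) (Mu j)) (resolution_orthogonal hP).
  by rewrite eq_sym (negbTE jn).
exact: cvg_unique cPx cu.
Unshelve. all: end_near. Qed.

Lemma ascp_resolution n x : ascp M n x = P n x.
Proof.
rewrite /ascp; case: xgetP => [u _ /resolution_expansion_unique -> //|].
by move=> /(_ _ (resolution_expansion x)).
Qed.

Lemma schauder_resolution : schauder_decomposition M.
Proof.
split=> [n|x].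
  split; first exact: closed_range_resolution.
    split=> [|a x y]; rewrite !inE; first by exists 0; rewrite // raddf0.
    by move=> [x' _ <-] [y' _ <-]; exists (a *: x' + y') => //; rewrite linearP.
  have [x Px0] := resolution_neq0 hP n.
  move=> M0; have : M n (P n x) by exists x.
  by rewrite M0 => /= Px; rewrite Px eqxx in Px0.
exists (fun n => P n x); split; first exact: resolution_expansion.
by move=> u /resolution_expansion_unique ->.
Qed.

Lemma normal_schauder_resolution : normal_schauder_decomposition M.
Proof.
split; first exact: schauder_resolution.
move=> n; apply/eqP; rewrite eq_le; apply/andP; split.
  apply: ge_ereal_sup => _ [x /= x1 <-]; rewrite lee_fin ascp_resolution.
  exact: le_trans (resolution_contractive hP n x) x1.
have [x Px0] := resolution_neq0 hP n.
apply: ereal_sup_ubound; exists (`|P n x|^-1 *: P n x).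
  by rewrite /= normrZ normfV normr_id mulVf// normr_eq0.
rewrite ascp_resolution linearZ/= resolution_idem.
by rewrite normrZ normfV normr_id mulVf// normr_eq0.
Qed.

(** The Luxemburg functional of [x + y] only sees the norms of its two nonzero
    coordinates, and not which components they belong to. *)
Lemma schauder_orlicz_norm i j k l x y z w :
  schauder_orlicz_decomposition M -> i != j -> k != l ->
  P i x = x -> P j y = y -> P k z = z -> P l w = w ->
  `|x| = `|z| -> `|y| = `|w| -> `|x + y| = `|z + w|.
Proof.
move=> [_ [Phi [_ Phi0 _ _ [Phi00 _]] lux]] ij kl Px Py Pz Pw xz yw.
have sumE m n (a b : X) (rho : R) : m != n -> P m a = a -> P n b = b -> 0 < rho ->
    (\sum_(0 <= q <oo) (Phi (`|ascp M q (a + b)| / rho))%:E =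
      (Phi (`|a| / rho) + Phi (`|b| / rho))%:E)%E.
  move=> mn Pa Pb rho0.
  have nm : n != m by rewrite eq_sym.
  have Phige0 q : (0 <= (Phi (`|ascp M q (a + b)| / rho))%:E)%E.
    by rewrite lee_fin Phi0// divr_ge0// ltW.
  rewrite (nneseriesD1 (n := m))// (nneseriesD1 (n := n))//.
  rewrite eseries0 ?adde0; last first.
    move=> q _ /=/andP[qm qn].
    rewrite ascp_resolution raddfD/= -Pa -Pb !(resolution_orthogonal hP).
    by rewrite (negbTE qm) (negbTE qn) addr0 normr0 mul0r Phi00.
  have -> : ascp M m (a + b) = a.
    rewrite ascp_resolution raddfD/= -Pa -Pb !(resolution_orthogonal hP).
    by rewrite eqxx (negbTE mn) addr0.
  have -> // : ascp M n (a + b) = b.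
  rewrite ascp_resolution raddfD/= -Pa -Pb !(resolution_orthogonal hP).
  by rewrite eqxx (negbTE nm) add0r.
apply: EFin_inj; rewrite -!lux; congr ereal_inf; congr image.
apply/funext => rho; apply/propext.
by split=> -[rho0 H]; split=> //; move: H;
  rewrite (sumE i j x y rho)// (sumE k l z w rho)// xz yw.
Qed.

End resolution.

(** * Splitting the first component into even and odd parts *)

Section split_first.
Context (R : realType) (X : normedModType R).
Variables (E : nat -> {linear X -> X}) (T : {linear X -> X}).
Hypothesis hE : contractive_resolution E.
Hypothesis TK : involutive T.
Hypothesis Tle : forall x, `|T x| <= `|x|.
Hypothesis TE : forall x, T (E 0 x) = E 0 (T x).

Definition split_first (n : nat) : {linear X -> X} :=
  match n with
  | 0 => 2^-1 \*: (E 0 \o (idfun \+ T))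
  | 1 => 2^-1 \*: (E 0 \o (idfun \- T))
  | k.+2 => E k.+1
  end.

Let scale_half_double (u : X) : 2^-1 *: (u + u) = u.
Proof.
have h : 2^-1 + 2^-1 = 1 :> R by field.
by rewrite scalerDr -scalerDl h scale1r.
Qed.

Lemma split_first0E x : split_first 0 x = 2^-1 *: (E 0 x + T (E 0 x)).
Proof. by rewrite /= raddfD/= TE. Qed.

Lemma split_first1E x : split_first 1 x = 2^-1 *: (E 0 x - T (E 0 x)).
Proof. by rewrite /= raddfB/= TE. Qed.

Lemma split_firstD x : split_first 0 x + split_first 1 x = E 0 x.
Proof.
rewrite split_first0E split_first1E -scalerDr addrACA subrr addr0.
exact: scale_half_double.
Qed.

Hypothesis split0 : exists x, E 0 x + T (E 0 x) != 0.
Hypothesis split1 : exists x, E 0 x - T (E 0 x) != 0.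

(** The even and odd parts of [E 0 x] are fixed by [E 0], killed by the other
    [E k], and are eigenvectors of [T] for 1 and -1; being half sums of two
    vectors of norm at most [`|x|], they are contractive images of [x]. *)
Lemma contractive_resolution_split : contractive_resolution split_first.
Proof.
have EE := resolution_orthogonal hE.
have half := scale_half_double.
have Eeven k x : E k (split_first 0 x) = if k == 0 then split_first 0 x else 0.
  rewrite split_first0E [LHS]linearZ raddfD/= TE !EE.
  by case: ifP; rewrite // addr0 scaler0.
have Eodd k x : E k (split_first 1 x) = if k == 0 then split_first 1 x else 0.
  rewrite split_first1E [LHS]linearZ raddfB/= TE !EE.
  by case: ifP; rewrite // subr0 scaler0.
have Teven x : T (split_first 0 x) = split_first 0 x.
  by rewrite split_first0E [LHS]linearZ raddfD/= TK addrC.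
have Todd x : T (split_first 1 x) = - split_first 1 x.
  by rewrite split_first1E [LHS]linearZ raddfB/= TK -scalerN opprB.
split.
- move=> [|[|i]] [|[|j]] x; rewrite ?eqxx.
  + by rewrite [LHS]split_first0E Eeven eqxx Teven half.
  + by rewrite [LHS]split_first0E Eodd eqxx Todd subrr scaler0.
  + by rewrite [LHS]split_first0E EE/= raddf0 addr0 scaler0.
  + by rewrite [LHS]split_first1E Eeven eqxx Teven subrr scaler0.
  + by rewrite [LHS]split_first1E Eodd eqxx Todd opprK half.
  + by rewrite [LHS]split_first1E EE/= raddf0 subr0 scaler0.
  + exact: Eeven.
  + exact: Eodd.
  + exact: EE.
- have half_le (u v w : X) : `|u| <= `|w| -> `|v| <= `|w| ->
      `|2^-1 *: (u + v)| <= `|w|.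
    move=> uw vw; rewrite normrZ ger0_norm ?invr_ge0//.
    rewrite ler_pdivrMl// (le_trans (ler_normD _ _))//.
    by rewrite mulr_natl mulr2n lerD.
  have E0le u v : `|u| <= `|v| -> `|E 0 u| <= `|v|.
    by move=> uv; exact: le_trans (resolution_contractive hE 0 u) uv.
  move=> [|[|i]] x; last exact: (resolution_contractive hE).
  + rewrite split_first0E TE; apply: half_le; exact: E0le.
  + by rewrite split_first1E TE; apply: half_le; rewrite ?normrN; exact: E0le.
- have half0 (u : X) : u != 0 -> 2^-1 *: u != 0.
    by move=> u0; rewrite scaler_eq0 invr_eq0 pnatr_eq0.
  move=> [|[|i]].
  + by have [x x0] := split0; exists x; rewrite split_first0E half0.
  + by have [x x0] := split1; exists x; rewrite split_first1E half0.
  + exact: (resolution_neq0 hE).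
- move=> x; rewrite -(cvg_shiftn 2)/=.
  have := @resolution_sum _ _ _ hE x; rewrite -(cvg_shiftn 1)/=.
  suff shiftE n : series (fun k => split_first k x) (n + 2)%N =
      series (fun k => E k x) (n + 1)%N.
    by rewrite (eq_cvg _ _ shiftE).
  rewrite /series/= addn2 addn1 !big_nat_recl//= -[in RHS]split_firstD.
  by rewrite addrA.
Qed.

End split_first.

(** * Norms and weighted composition operators in L_p *)

Section Lspace_operators.
Context d (T : measurableType d) (R : realType).
Variables (mu : {measure set T -> \bar R}) (p : R) (p1 : (1 <= p%:E)%E).

Local Notation L := (LspaceType mu p1).
Implicit Types (x y : L) (f : T -> R).

Lemma exponent_gt0 : 0 < p.
Proof. by move: p1; rewrite lee_fin; exact: lt_le_trans. Qed.
Let p0 := exponent_gt0.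

Lemma measurable_powR_norm f : measurable_fun setT f ->
  measurable_fun setT ((fun t => (`|f t| `^ p)%:E) : T -> \bar R).
Proof.
move=> mf; apply/measurable_EFinP.
exact: (measurableT_comp (@measurable_powR R p)
  (measurableT_comp (@normr_measurable R setT) mf)).
Qed.

Lemma Lnorm_powR f :
  ('N[mu]_(p%:E)[EFin \o f] `^ p = \int[mu]_t (`|f t| `^ p)%:E)%E.
Proof. by rewrite poweR_Lnorm ?gt_eqF. Qed.

Lemma Lspace_norm_powR x :
  ((`|x| `^ p)%:E = \int[mu]_t (`|(x : T -> R) t| `^ p)%:E)%E.
Proof. by rewrite -Lnorm_powR -Lspace_normE poweR_EFin. Qed.

Lemma mem_Lfun f : measurable_fun setT f ->
  (\int[mu]_t (`|f t| `^ p)%:E < +oo)%E -> f \in Lfun mu p%:E.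
Proof.
move=> mf fin; apply/andP; split; rewrite inE//=.
by apply: (@lty_poweRy _ _ p); rewrite ?gt_eqF ?Lnorm_powR.
Qed.

Lemma Lspace_int_powR_lty x : (\int[mu]_t (`|(x : T -> R) t| `^ p)%:E < +oo)%E.
Proof. by rewrite -Lspace_norm_powR ltry. Qed.

(** Restriction to a set and composition with a measure-preserving map are both
    of the form f |-> w * (f o phi) with a weight bounded by 1; linearity and
    contractivity are proved once for this family. *)
Section weighted_composition.
Variables (w : T -> R) (phi : T -> T).
Hypothesis mw : measurable_fun setT w.
Hypothesis w1 : forall t, `|w t| <= 1.
Hypothesis mphi : measurable_fun setT phi.
Hypothesis muphi : forall A, measurable A -> mu (phi @^-1` A) = mu A.

Lemma measurable_weighted f : measurable_fun setT f ->
  measurable_fun setT (fun t => w t * f (phi t)).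
Proof. by move=> mf; apply: measurable_funM => //; exact: measurableT_comp. Qed.

Lemma int_powR_weighted f : measurable_fun setT f ->
  (\int[mu]_t (`|w t * f (phi t)| `^ p)%:E <= \int[mu]_t (`|f t| `^ p)%:E)%E.
Proof.
move=> mf.
have -> : (\int[mu]_t (`|f t| `^ p)%:E = \int[mu]_t (`|f (phi t)| `^ p)%:E)%E.
  rewrite -[RHS](@ge0_integral_pushforward _ _ _ _ _ _ mphi mu setT
    (fun t => (`|f t| `^ p)%:E))//; last exact: measurable_powR_norm.
  by apply: eq_measure_integral => A mA _; rewrite -(muphi mA).
apply: ge0_le_integral => //.
- exact/measurable_powR_norm/measurable_weighted.
- by apply: measurable_powR_norm; exact: measurableT_comp.
- move=> t _; rewrite lee_fin ge0_ler_powR ?nnegrE// ?(ltW p0)//.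
  by rewrite normrM ler_piMl.
Qed.

(** As [phi] preserves the measure, it pulls null sets back to null sets, which
    lets composition with [phi] act on classes of functions. *)
Lemma ae_preimage (Q : T -> Prop) :
  {ae mu, forall t, Q t} -> {ae mu, forall t, Q (phi t)}.
Proof.
move=> [N [mN N0 subN]]; exists (phi @^-1` N); split.
- by rewrite -[X in measurable X]setTI; exact: mphi.
- by rewrite muphi.
- by move=> t /= Qt; exact: subN.
Qed.

Lemma ae_eq_weighted f g : f = g %[ae mu] ->
  (fun t => w t * f (phi t)) = (fun t => w t * g (phi t)) %[ae mu].
Proof. by move=> /ae_preimage; apply: filterS => t fg _; rewrite fg. Qed.

Lemma weighted_Lfun x : (fun t => w t * (x : T -> R) (phi t)) \in Lfun mu p%:E.
Proof.
have mx := Lspace_measurable x; apply: mem_Lfun; first exact: measurable_weighted.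
exact: le_lt_trans (int_powR_weighted mx) (Lspace_int_powR_lty x).
Qed.

Definition weighted_composition x : L := Lspace_of (Lfun_Sub p1 (weighted_Lfun x)).

Lemma weighted_compositionE x :
  (weighted_composition x : T -> R) = (fun t => w t * (x : T -> R) (phi t)) %[ae mu].
Proof. exact: Lspace_ofE. Qed.

Lemma weighted_composition_linear : linear weighted_composition.
Proof.
move=> a x y; apply/Lspace_eqP.
apply: ae_eq_trans (weighted_compositionE _) _.
have xyE : ((a *: x + y : L) : T -> R) =
    (fun t => a * (x : T -> R) t + (y : T -> R) t) %[ae mu].
  apply: filterS2 (Lspace_addE (a *: x) y) (Lspace_scaleE a x) => t E1 E2 _.
  by rewrite E1// E2.
apply: ae_eq_trans (ae_eq_weighted xyE) _; apply: ae_eq_sym.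
apply: filterS3 (Lspace_addE (a *: weighted_composition x) (weighted_composition y))
  (Lspace_scaleE a (weighted_composition x))
  (filterI (weighted_compositionE x) (weighted_compositionE y)) => t E1 E2 [E3 E4] _.
by rewrite E1// E2// E3// E4// mulrDr mulrCA.
Qed.

HB.instance Definition _ :=
  GRing.isLinear.Build R L L *:%R weighted_composition weighted_composition_linear.

Lemma ler_norm_weighted_composition x : `|weighted_composition x| <= `|x|.
Proof.
suff : `|weighted_composition x| `^ p <= `|x| `^ p.
  by apply: contraTT; rewrite -!ltNge; apply: gt0_ltr_powR; rewrite ?nnegrE.
rewrite -lee_fin !Lspace_norm_powR; apply: le_trans (int_powR_weighted _); last first.
  exact: Lspace_measurable.
rewrite le_eqVlt; apply/orP; left; apply/eqP.
apply: ae_eq_integral => //.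
- exact/measurable_powR_norm/Lspace_measurable.
- exact/measurable_powR_norm/measurable_weighted/Lspace_measurable.
- by apply: filterS (weighted_compositionE x) => t /[apply] ->.
Qed.

End weighted_composition.

(** * Restrictions to measurable sets *)

Section restriction.
Variables (A : set T) (mA : measurable A).

Lemma normr_indic_le1 t : `|\1_A t : R| <= 1.
Proof. by rewrite indicE; case: (_ \in _); rewrite ?normr1 ?normr0. Qed.

Definition Lspace_restr : {linear L -> L} :=
  weighted_composition (measurable_indic mA) normr_indic_le1
    (@measurable_id _ T _) (fun B _ => erefl (mu B)).

Lemma Lspace_restrE x :
  (Lspace_restr x : T -> R) = (fun t => \1_A t * (x : T -> R) t) %[ae mu].
Proof. exact: weighted_compositionE. Qed.

Lemma ler_norm_Lspace_restr x : `|Lspace_restr x| <= `|x|.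
Proof. exact: ler_norm_weighted_composition. Qed.

End restriction.

Lemma eq_Lspace_restr (A B : set T) (mA : measurable A) (mB : measurable B) x :
  A = B -> Lspace_restr mA x = Lspace_restr mB x.
Proof. by move=> AB; subst B; rewrite (Prop_irrelevance mA mB). Qed.

Lemma Lspace_restrI (A B : set T) (mA : measurable A) (mB : measurable B) x :
  Lspace_restr mA (Lspace_restr mB x) = Lspace_restr (measurableI _ _ mA mB) x.
Proof.
apply/Lspace_eqP; apply: filterS3 (Lspace_restrE mA (Lspace_restr mB x))
  (Lspace_restrE mB x) (Lspace_restrE (measurableI _ _ mA mB) x) => t E1 E2 E3 _.
by rewrite E1// E2// E3// indicI mulrA.
Qed.

Lemma Lspace_restr0 x : Lspace_restr measurable0 x = 0.
Proof.
apply/Lspace_eqP; apply: filterS2 (Lspace_restrE measurable0 x)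
  (Lspace_ofE (0 : LfunType mu p1)) => t E1 E2 _.
by rewrite E1// E2// indic0 mul0r.
Qed.

Lemma Lspace_restrT x : Lspace_restr measurableT x = x.
Proof.
apply/Lspace_eqP; apply: filterS (Lspace_restrE measurableT x) => t E1 _.
by rewrite E1// indicT mul1r.
Qed.

Lemma Lspace_restrU (A B : set T) (mA : measurable A) (mB : measurable B) x :
  A `&` B = set0 ->
  Lspace_restr (measurableU _ _ mA mB) x = Lspace_restr mA x + Lspace_restr mB x.
Proof.
move=> AB0; apply/Lspace_eqP.
apply: filterS3 (Lspace_restrE (measurableU _ _ mA mB) x)
  (Lspace_addE (Lspace_restr mA x) (Lspace_restr mB x))
  (filterI (Lspace_restrE mA x) (Lspace_restrE mB x)) => t E1 E2 [E3 E4] _.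
rewrite E1// E2// E3// E4// -mulrDl !indicE in_setU; congr (_ * _).
case: (boolP (t \in A)) => tA; case: (boolP (t \in B)) => tB;
  rewrite ?addr0 ?add0r//.
by have : (A `&` B) t by [split; exact: set_mem]; rewrite AB0.
Qed.

(** At almost every point one of the two functions vanishes. *)
Lemma Lspace_normD_disjoint (A B : set T) (mA : measurable A) (mB : measurable B)
    x y : A `&` B = set0 -> Lspace_restr mA x = x -> Lspace_restr mB y = y ->
  `|x + y| `^ p = `|x| `^ p + `|y| `^ p.
Proof.
move=> AB0 Ax By; apply: EFin_inj; rewrite EFinD !Lspace_norm_powR.
have mL (z : L) := measurable_powR_norm (Lspace_measurable z).
rewrite -ge0_integralD//.
have xE : (x : T -> R) = (fun t => \1_A t * (x : T -> R) t) %[ae mu].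
  by apply: ae_eq_trans (Lspace_restrE mA x); apply/Lspace_eqP; rewrite Ax.
have yE : (y : T -> R) = (fun t => \1_B t * (y : T -> R) t) %[ae mu].
  by apply: ae_eq_trans (Lspace_restrE mB y); apply/Lspace_eqP; rewrite By.
apply: ae_eq_integral => //; first exact: emeasurable_funD.
apply: filterS3 xE yE (Lspace_addE x y) => t /(_ I) xt /(_ I) yt /(_ I) -> _.
rewrite -EFinD; congr EFin; case: (boolP (t \in A)) => tA.
  have tB : t \notin B.
    apply/negP => tB.
    by have : (A `&` B) t by [split; exact: set_mem]; rewrite AB0.
  by rewrite yt indicE (negbTE tB) mul0r addr0 normr0 powR0 ?gt_eqF ?addr0.
by rewrite xt indicE (negbTE tA) mul0r add0r normr0 powR0 ?gt_eqF ?add0r.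
Qed.

Lemma int_powR_indic (A : set T) : measurable A ->
  (\int[mu]_t (`|\1_A t : R| `^ p)%:E = mu A)%E.
Proof.
move=> mA; rewrite -[in RHS](setIT A) -(integral_indic _ measurableT)//.
apply: eq_integral => t _; rewrite indicE.
by case: (_ \in _); rewrite ?normr1 ?normr0 ?powR1 ?powR0 ?gt_eqF.
Qed.

Lemma exists_supported (A : set T) (mA : measurable A) :
  (mu setT < +oo)%E -> (0 < mu A)%E ->
  exists2 y : L, Lspace_restr mA y = y & y != 0.
Proof.
move=> muT muA0.
have iL : (\1_A : T -> R) \in Lfun mu p%:E.
  apply: mem_Lfun; first exact: measurable_indic.
  by rewrite int_powR_indic// (le_lt_trans _ muT)// le_measure// inE.
pose y : L := Lspace_of (Lfun_Sub p1 iL).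
have yE : (y : T -> R) = \1_A %[ae mu] by exact: Lspace_ofE.
have Ay : Lspace_restr mA y = y.
  apply/Lspace_eqP; apply: filterS2 (Lspace_restrE mA y) yE => t E1 E2 _.
  by rewrite E1// E2// -[in RHS](setIid A) indicI.
have y0 : y != 0.
  apply/eqP => y0; have := Lspace_norm_powR y.
  rewrite {1}y0 normr0 powR0 ?gt_eqF// => intE.
  suff : mu A = 0%E by move=> muA; rewrite muA ltxx in muA0.
  rewrite -(int_powR_indic mA) [RHS]intE; apply: ae_eq_integral => //.
  - exact/measurable_powR_norm/measurable_indic.
  - exact/measurable_powR_norm/Lspace_measurable.
  - by apply: filterS yE => t /[apply] ->.
by exists y.
Qed.

Section partition.
Variable A : nat -> set T.
Hypothesis mA : forall n, measurable (A n).
Hypothesis tA : trivIset setT A.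

Let mU n : measurable (\big[setU/set0]_(k < n) A k).
Proof. exact: bigsetU_measurable. Qed.

Lemma series_Lspace_restr n x :
  series (fun k => Lspace_restr (mA k) x) n = Lspace_restr (mU n) x.
Proof.
elim: n => [|n IHn].
  rewrite /series/= big_nil -[LHS](Lspace_restr0 x).
  by apply: eq_Lspace_restr; rewrite big_ord0.
rewrite seriesSr IHn -Lspace_restrU.
  by apply: eq_Lspace_restr; rewrite big_ord_recr.
rewrite -subset0 => t [+ Ant].
rewrite -bigcup_mkord => -[k /= kn Akt].
have kE := tA I I (ex_intro _ t (conj Akt Ant)).
by rewrite kE ltnn in kn.
Qed.

Hypothesis coverA : {ae mu, forall t, exists n, A n t}.

(** The remainders are the restrictions of [x] to sets decreasing to a null set;
    the p-th powers of their norms tend to 0 by dominated convergence. *)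
Lemma cvg_series_Lspace_restr x :
  series (fun k => Lspace_restr (mA k) x) @ \oo --> x.
Proof.
pose N n := Lspace_restr (measurableC (mU n)) x.
pose f n t := (`|\1_(~` \big[setU/set0]_(k < n) A k) t * (x : T -> R) t| `^ p)%:E.
have mx := Lspace_measurable x.
have mf n : measurable_fun setT (f n).
  apply: measurable_powR_norm.
  exact: measurable_funM (measurable_indic (measurableC (mU n))) mx.
have NE n : ((`|N n| `^ p)%:E = \int[mu]_t f n t)%E.
  rewrite Lspace_norm_powR; apply: ae_eq_integral => //.
    exact/measurable_powR_norm/Lspace_measurable.
  by apply: filterS (Lspace_restrE (measurableC (mU n)) x) => t /[apply] ->.
have Ncvg : (`|N n| `^ p)%:E @[n --> \oo] --> (0 : \bar R).
  under eq_fun do rewrite NE.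
  have [||||_ _] := @dominated_convergence _ _ _ mu setT measurableT f (cst 0%E)
    (fun t => (`|(x : T -> R) t| `^ p)%:E) mf.
  - exact: measurable_cst.
  - apply: filterS coverA => t [k Akt] _; apply: cvg_near_cst; near=> n.
    rewrite /f indicE memNset ?mul0r ?normr0 ?powR0 ?gt_eqF//= => /=.
    by apply; rewrite -bigcup_mkord; exists k => //=; near: n; exact: nbhs_infty_gt.
  - apply/integrableP; split; first exact: measurable_powR_norm.
    under eq_integral do rewrite /= ger0_norm ?powR_ge0//.
    exact: Lspace_int_powR_lty.
  - apply: aeW => t n _; rewrite /f lee_fin ger0_norm ?powR_ge0//.
    rewrite ge0_ler_powR ?nnegrE// ?(ltW p0)//.
    by rewrite normrM ler_piMl// normr_indic_le1.
  by rewrite integral0.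
apply/cvgrPdist_lt => e e0.
have /fine_cvg/= Ncvg' := Ncvg.
have ep0 : 0 < e `^ p by rewrite powR_gt0.
near=> n.
have -> : x - series (fun k => Lspace_restr (mA k) x) n = N n.
  rewrite series_Lspace_restr; apply/eqP; rewrite subr_eq addrC; apply/eqP.
  rewrite -Lspace_restrU ?setICr// -[LHS]Lspace_restrT.
  by apply: eq_Lspace_restr; rewrite setUCr.
have : `|N n| `^ p < e `^ p by near: n; exact: cvgr_lt Ncvg' _ ep0.
apply: contraTT; rewrite -!leNgt => eN.
by rewrite ge0_ler_powR ?nnegrE// ?(ltW p0)// ltW.
Unshelve. all: end_near. Qed.

Hypothesis muA_gt0 : forall n, (0 < mu (A n))%E.
Hypothesis muT : (mu setT < +oo)%E.

Lemma contractive_resolution_restr :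
  contractive_resolution (fun n => Lspace_restr (mA n)).
Proof.
split.
- move=> i j x; rewrite Lspace_restrI; case: eqVneq => [ij|ij].
    by apply: eq_Lspace_restr; rewrite ij setIid.
  rewrite -[RHS](Lspace_restr0 x); apply: eq_Lspace_restr.
  by have /trivIsetP := tA; apply.
- by move=> n x; exact: ler_norm_Lspace_restr.
- move=> n; have [y Ay y0] := exists_supported (mA n) muT (muA_gt0 n).
  by exists y; rewrite Ay.
- exact: cvg_series_Lspace_restr.
Qed.

End partition.

(** * Composition with a measure-preserving involution *)

Section reflection.
Variable sigma : T -> T.
Hypothesis msigma : measurable_fun setT sigma.
Hypothesis musigma : forall A, measurable A -> mu (sigma @^-1` A) = mu A.
Hypothesis sigmaK : involutive sigma.

Lemma normr1_le1 (t : T) : `|cst 1 t : R| <= 1.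
Proof. by rewrite normr1. Qed.

Let mone : measurable_fun setT (cst 1 : T -> R).
Proof. exact: measurable_cst. Qed.

Definition Lspace_comp : {linear L -> L} :=
  weighted_composition mone normr1_le1 msigma musigma.

Lemma Lspace_compE x :
  (Lspace_comp x : T -> R) = (x : T -> R) \o sigma %[ae mu].
Proof.
apply: ae_eq_trans (weighted_compositionE _ _ _ _ x) _.
by apply: aeW => t _; rewrite /= mul1r.
Qed.

Lemma ler_norm_Lspace_comp x : `|Lspace_comp x| <= `|x|.
Proof. exact: ler_norm_weighted_composition. Qed.

Lemma Lspace_compK : involutive Lspace_comp.
Proof.
move=> x; apply/Lspace_eqP.
apply: filterS2 (Lspace_compE (Lspace_comp x)) (ae_preimage msigma musigma (Lspace_compE x)).
by move=> t E1 E2 _; rewrite E1//= E2//= sigmaK.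
Qed.

Lemma Lspace_norm_comp x : `|Lspace_comp x| = `|x|.
Proof.
apply/eqP; rewrite eq_le ler_norm_Lspace_comp/=.
by rewrite -[in leLHS](Lspace_compK x) ler_norm_Lspace_comp.
Qed.

Lemma Lspace_comp_restr (A B : set T) (mA : measurable A) (mB : measurable B) x :
  sigma @^-1` A = B ->
  Lspace_comp (Lspace_restr mA x) = Lspace_restr mB (Lspace_comp x).
Proof.
move=> AB; apply/Lspace_eqP.
apply: filterS2 (Lspace_compE (Lspace_restr mA x))
  (filterI (Lspace_restrE mB (Lspace_comp x))
    (filterI (Lspace_compE x) (ae_preimage msigma musigma (Lspace_restrE mA x)))).
move=> t E1 [E2 [E3 E4]] _; rewrite E1//= E4// E2// E3//=; congr (_ * _).
by rewrite -AB !indicE; congr (_%:R); apply/idP/idP; rewrite !inE.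
Qed.

(** [x] and its reflection have disjoint supports and the same norm. *)
Lemma norm_reflection (H : set T) (mH : measurable H) x :
  H `&` sigma @^-1` H = set0 -> Lspace_restr mH x = x ->
  `|x + Lspace_comp x| `^ p = `|x| `^ p *+ 2 /\
  `|x - Lspace_comp x| `^ p = `|x| `^ p *+ 2.
Proof.
move=> H0 Hx.
have mH' : measurable (sigma @^-1` H).
  by rewrite -[X in measurable X]setTI; exact: msigma.
have Hsx : Lspace_restr mH' (Lspace_comp x) = Lspace_comp x.
  by rewrite -[in RHS]Hx; apply/esym/Lspace_comp_restr.
split; rewrite (Lspace_normD_disjoint H0 Hx (_ : Lspace_restr mH' _ = _))
  ?normrN ?Lspace_norm_comp//.
by rewrite linearN/= Hsx.
Qed.

End reflection.

End Lspace_operators.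

(** * A decomposition that is not Schauder-Orlicz *)

(** [A] is a partition whose first piece is symmetric for the involution [sigma],
    and [H] is a part of that piece which is disjoint from its reflection. *)
Section non_orlicz.
Context d (T : measurableType d) (R : realType).
Variables (mu : {measure set T -> \bar R}) (p : R) (p1 : (1 <= p%:E)%E).
Variable sigma : T -> T.
Hypothesis msigma : measurable_fun setT sigma.
Hypothesis musigma : forall A, measurable A -> mu (sigma @^-1` A) = mu A.
Hypothesis sigmaK : involutive sigma.
Variable A : nat -> set T.
Hypothesis mA : forall n, measurable (A n).
Hypothesis tA : trivIset setT A.
Hypothesis coverA : {ae mu, forall t, exists n, A n t}.
Hypothesis muA_gt0 : forall n, (0 < mu (A n))%E.
Hypothesis muT : (mu setT < +oo)%E.
Hypothesis sigmaA : sigma @^-1` (A 0) = A 0.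
Variable H : set T.
Hypothesis mH : measurable H.
Hypothesis HA : H `<=` A 0.
Hypothesis muH_gt0 : (0 < mu H)%E.
Hypothesis Hsigma : H `&` sigma @^-1` H = set0.

Local Notation L := (LspaceType mu p1).

Let E n : {linear L -> L} := Lspace_restr mu p1 (mA n).
Let S : {linear L -> L} := Lspace_comp p1 msigma musigma.
Let P := split_first E S.

Let hE : contractive_resolution E.
Proof. exact: contractive_resolution_restr. Qed.

Let SE x : S (E 0 x) = E 0 (S x).
Proof. exact: Lspace_comp_restr. Qed.

(** Both [y + S y] and [y - S y] have the norm 2^(1/p) [`|y|]: the even and odd
    parts of [y] have equal norms and are nonzero. *)
Lemma exists_half_supported :
  exists y : L, [/\ E 0 y = y, y != 0, `|y + S y| `^ p = `|y| `^ p *+ 2 &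
                   `|y - S y| `^ p = `|y| `^ p *+ 2].
Proof.
have [y Hy y0] := exists_supported p1 mH muT muH_gt0.
have [yp ym] := norm_reflection msigma musigma sigmaK Hsigma Hy.
exists y; split=> //.
rewrite -{1}Hy /E Lspace_restrI -[RHS]Hy; apply: eq_Lspace_restr.
exact/setIidr.
Qed.

Let powR_norm_neq0 (x : L) : (`|x| `^ p == 0) = (x == 0).
Proof. by rewrite powR_eq0 normr_eq0 gt_eqF ?(exponent_gt0 p1)// andbT. Qed.

Lemma contractive_resolution_reflected : contractive_resolution P.
Proof.
have [y [Ey y0 yp ym]] := exists_half_supported.
have yp0 : `|y| `^ p *+ 2 != 0 by rewrite mulrn_eq0/= powR_norm_neq0.
apply: contractive_resolution_split => //.
- exact: Lspace_compK.
- exact: ler_norm_Lspace_comp.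
- by exists y; rewrite Ey -powR_norm_neq0 yp.
- by exists y; rewrite Ey -powR_norm_neq0 ym.
Qed.

Lemma exists_supported_norm n (c : R) : 0 <= c ->
  exists2 x : L, E n x = x & `|x| = c.
Proof.
move=> c0; have [x Ex x0] := exists_supported p1 (mA n) muT (muA_gt0 n).
exists ((c / `|x|) *: x); first by rewrite linearZ/= Ex.
by rewrite normrZ ger0_norm ?divr_ge0// mulfVK// normr_eq0.
Qed.

(** The even and odd parts of [y] are compared with vectors [z] and [w] of the same
    norms in [range (P 2)] and [range (P 3)], that is, supported in [A 1] and
    [A 2]: the resulting equation is 2^p = 4. *)
Lemma not_schauder_orlicz_reflected : p != 2 ->
  ~ schauder_orlicz_decomposition (fun n => range (P n)).
Proof.
move=> /eqP p2 orl; apply: p2; have p0 := exponent_gt0 p1.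
have hP := contractive_resolution_reflected.
have [y [Ey y0 yp ym]] := exists_half_supported.
have yP : P 0 y + P 1 y = y by rewrite /P split_firstD.
have halfE (u : L) : `|u| `^ p = `|y| `^ p *+ 2 ->
    2 `^ p * `|2^-1 *: u| `^ p = `|y| `^ p *+ 2.
  by move=> <-; rewrite -powRM// normrZ ger0_norm ?invr_ge0// mulVKf.
have P0E : 2 `^ p * `|P 0 y| `^ p = `|y| `^ p *+ 2.
  by rewrite -(halfE _ yp) /P split_first0E// Ey.
have P1E : 2 `^ p * `|P 1 y| `^ p = `|y| `^ p *+ 2.
  by rewrite -(halfE _ ym) /P split_first1E// Ey.
have P01 : `|P 0 y| = `|P 1 y|.
  have tp : 2 `^ p != 0 :> R by rewrite powR_eq0 pnatr_eq0.
  by apply: (powR_injective p0); rewrite ?nnegrE//; apply: (mulfI tp); rewrite P0E.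
have [z Ez zP] := exists_supported_norm 1 (normr_ge0 (P 0 y)).
have [w Ew wP] := exists_supported_norm 2 (normr_ge0 (P 1 y)).
have zw : `|y| = `|z + w|.
  rewrite -yP; apply: (@schauder_orlicz_norm _ _ _ hP 0 1 2 3) => //.
  - exact: (resolution_idem hP 0).
  - exact: (resolution_idem hP 1).
have zwp : `|z + w| `^ p = `|z| `^ p + `|w| `^ p.
  by apply: (Lspace_normD_disjoint _ Ez Ew); have /trivIsetP := tA; apply.
have c0 : `|P 0 y| `^ p != 0.
  apply: contra_neq y0 => c0; apply/eqP; rewrite -powR_norm_neq0.
  by move: P0E; rewrite c0 mulr0 => /esym/eqP; rewrite mulrn_eq0.
(* cancelling the common norm leaves 2^p = 2 * 2, solved for p by logarithms *)
move: P0E; rewrite zw zwp zP wP -P01 -mulr2n -mulrnA -[RHS]mulr_natl.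
move=> /(mulIf c0) /(congr1 (@ln R)).
have -> : (2 * 2)%:R = 2 ^+ 2 :> R by rewrite natrM expr2.
rewrite ln_powR lnXn// -[RHS]mulr_natl; apply: mulIf.
by rewrite gt_eqF// ln_gt0// ltr1n.
Qed.

End non_orlicz.

(** * The unit interval cut into symmetric shells *)

Section reflected_unit_interval.
Variable R : realType.
Local Notation mu := (lebesgue01 R).
Local Notation leb := (@lebesgue_measure R).

Definition reflection01 (t : measurableTypeR R) : measurableTypeR R := 1 - t.

Lemma reflection01K : involutive reflection01.
Proof. by move=> t; rewrite /reflection01 subKr. Qed.

Lemma measurable_reflection01 : measurable_fun setT reflection01.
Proof. exact: measurable_funB. Qed.

HB.instance Definition _ := isMeasurableFun.Build _ _ _ _ _ measurable_reflection01.

Lemma lebesgue_reflection01 (B : set (measurableTypeR R)) :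
  measurable B -> leb (reflection01 @^-1` B) = leb B.
Proof.
move=> mB; apply/esym.
rewrite -[RHS]/(pushforward leb reflection01 B).
apply: lebesgue_measure_unique => // _ [[a b]] _ <-; rewrite /= /pushforward.
have -> : reflection01 @^-1` `]a, b] = `[1 - b, 1 - a[%classic.
  apply/seteqP; split=> t /=; rewrite !in_itv/= /reflection01 => /andP[? ?];
    apply/andP; split; lra.
rewrite !lebesgue_measure_itv/= !lte_fin ltrD2l ltrN2.
by case: ifP => // _; rewrite -!EFinB; congr EFin; lra.
Qed.

Lemma lebesgue01E (B : set (measurableTypeR R)) :
  mu B = leb (B `&` `]0, 1[%classic).
Proof. by []. Qed.

Lemma lebesgue01_reflection (B : set (measurableTypeR R)) :
  measurable B -> mu (reflection01 @^-1` B) = mu B.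
Proof.
move=> mB; rewrite !lebesgue01E.
rewrite -[RHS]lebesgue_reflection01; last exact: measurableI.
rewrite preimage_setI; congr (leb (_ `&` _)).
by apply/seteqP; split=> t /=; rewrite !in_itv/= /reflection01 => /andP[? ?];
  apply/andP; split; lra.
Qed.

Lemma lebesgue01_itv (a b : R) : 0 <= a -> a < b -> b <= 1 ->
  mu `]a, b[%classic = (b - a)%:E.
Proof.
move=> a0 ab b1; rewrite lebesgue01E setIidl; last first.
  move=> t /=; rewrite !in_itv/= => /andP[at_ tb].
  by rewrite (le_lt_trans a0 at_) (lt_le_trans tb b1).
by rewrite lebesgue_measure_itv/= lte_fin ab EFinB.
Qed.

(** Starting at 1/3 leaves room for a first shell of positive measure. *)
Definition margin (n : nat) : R := n.+3%:R^-1.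

Definition centered_itv (n : nat) : set (measurableTypeR R) :=
  `]margin n, 1 - margin n[%classic.

Lemma margin0 : margin 0 = 3^-1. Proof. by []. Qed.

Lemma margin_gt0 n : 0 < margin n.
Proof. by rewrite invr_gt0. Qed.

Lemma margin_le n : margin n <= 3^-1.
Proof. by rewrite lef_pV2 ?posrE// ler_nat. Qed.

Lemma margin_decreasing n : margin n.+1 < margin n.
Proof. by rewrite ltf_pV2 ?posrE// ltr_nat. Qed.

Lemma nondecreasing_centered_itv : nondecreasing_seq centered_itv.
Proof.
apply/nondecreasing_seqP => n; apply/subsetPset => t.
rewrite /centered_itv/= !in_itv/=; have := margin_decreasing n => ? /andP[? ?].
by apply/andP; split; lra.
Qed.

Let A := seqD centered_itv.

Lemma measurable_shell n : measurable (A n).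
Proof. by case: n => [|n] /=; [|apply: measurableD]; exact: measurable_itv. Qed.

(** The shell of index n.+1 contains the interval between two successive margins. *)
Lemma shell_gt0 n : (0 < mu (A n))%E.
Proof.
have itv_gt0 (a b : R) : 0 <= a -> a < b -> b <= 1 ->
    `]a, b[%classic `<=` A n -> (0 < mu (A n))%E.
  move=> a0 ab b1 sub.
  rewrite (@lt_le_trans _ _ (mu `]a, b[%classic))//.
    by rewrite lebesgue01_itv// lte_fin subr_gt0.
  by rewrite le_measure// inE; [exact: measurable_itv|exact: measurable_shell].
case: n itv_gt0 => [|n] itv_gt0.
  by apply: (itv_gt0 3^-1 (1 - 3^-1)) => //; lra.
have := margin_gt0 n.+1; have := margin_le n; have := margin_decreasing n => ? ? ?.
apply: (itv_gt0 (margin n.+1) (margin n)); [lra|lra|lra|].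
move=> t; rewrite /A/= /centered_itv/= !in_itv/= => /andP[? ?].
split; first by apply/andP; split; lra.
by move=> /andP[? ?]; lra.
Qed.

Lemma shell_cover : {ae mu, forall t, exists n, A n t}.
Proof.
exists (~` `]0, 1[%classic); split.
- by apply: measurableC; exact: measurable_itv.
- by rewrite lebesgue01E setICl measure0.
- move=> t /= H; rewrite in_itv/= => /andP[t0 t1]; apply: H.
  suff [n _ Ant] : (\bigcup_n A n) t by exists n.
  rewrite eq_bigcup_seqD.
  have m0 : 0 < Num.min t (1 - t) by rewrite lt_min t0 subr_gt0.
  have [n _ nt] := near_infty_natSinv_lt (PosNum m0).
  exists n => //; rewrite /centered_itv/= in_itv/=.
  have : margin n <= n.+1%:R^-1 by rewrite lef_pV2 ?posrE// ler_nat ltnW.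
  have := nt n (leqnn n); rewrite lt_min/=; move: (n.+1%:R^-1) => e /andP[? ?] ?.
  by apply/andP; split; lra.
Qed.

Definition shell0_left_half : set (measurableTypeR R) := `]3^-1, 2^-1[%classic.

Lemma measurable_shell0_left_half : measurable shell0_left_half.
Proof. exact: measurable_itv. Qed.

Lemma shell0_left_half_sub : shell0_left_half `<=` A 0.
Proof.
move=> t; rewrite /shell0_left_half /A/= /centered_itv/= margin0 !in_itv/= => /andP[? ?].
by apply/andP; split; lra.
Qed.

Lemma shell0_left_half_gt0 : (0 < mu shell0_left_half)%E.
Proof. by rewrite lebesgue01_itv ?lte_fin; lra. Qed.

Lemma shell0_left_half_reflection : shell0_left_half `&` reflection01 @^-1` shell0_left_half = set0.
Proof.
rewrite -subset0 => t []; rewrite /shell0_left_half/= !in_itv/= /reflection01.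
by move=> /andP[? ?] /andP[? ?]; lra.
Qed.

Lemma shell0_reflection : reflection01 @^-1` A 0 = A 0.
Proof.
apply/seteqP; split=> t; rewrite /A/= /centered_itv/= !in_itv/= /reflection01;
  by move=> /andP[? ?]; apply/andP; split; lra.
Qed.

Lemma lebesgue01_lty : (mu setT < +oo)%E.
Proof. by rewrite lebesgue01E setTI lebesgue_measure_itv/= lte01 ltry. Qed.

End reflected_unit_interval.

Theorem corollary25 (R : realType) (p : R) (p1 : (1 <= p%:E)%E) (p2 : p != 2) :
  exists M : nat -> set (LspaceType (lebesgue01 R) p1),
    normal_schauder_decomposition M /\ ~ schauder_orlicz_decomposition M.
Proof.
have sigmaK := @reflection01K R.
have tA := trivIset_seqD (@nondecreasing_centered_itv R).
have msigma := @measurable_reflection01 R.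
have hP := contractive_resolution_reflected p1 msigma (@lebesgue01_reflection R)
  sigmaK (@measurable_shell R) tA (@shell_cover R) (@shell_gt0 R)
  (@lebesgue01_lty R) (@shell0_reflection R) (@measurable_shell0_left_half R)
  (@shell0_left_half_sub R) (@shell0_left_half_gt0 R) (@shell0_left_half_reflection R).
eexists; split; first exact: normal_schauder_resolution hP.
exact: (not_schauder_orlicz_reflected sigmaK tA (@shell_cover R) (@shell_gt0 R)
  (@lebesgue01_lty R) (@shell0_reflection R) (@measurable_shell0_left_half R)
  (@shell0_left_half_sub R) (@shell0_left_half_gt0 R) (@shell0_left_half_reflection R) p2).
Qed.
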